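(* For every $n=1,2,\ldots$, the operator $G_n:C[0,\pi]\to C[0,\pi]$ is not bounded with respect to the $L^1$-norm on $[0,\pi]$; that is, there is no constant $C$ such that $\|G_n(f)\|_1\le C\|f\|_1$ for all $f\in C[0,\pi]$, where $\|f\|_1=\int_0^\pi|f(t)|\,dt$.
   Context: For $n\in\mathbb{N}$ and $k=1,\dots,n$ let $\theta_k^{(n)}=\frac{(2k-1)\pi}{2n}$ and, for real $\theta$, let $$P_k(\theta)=(-1)^{k+1}\frac{\cos(n\theta)\sin\theta_k^{(n)}}{n(\cos\theta-\cos\theta_k^{(n)})}$$ (the dependence on $n$ is suppressed; $P_k$ is extended by continuity at the removable singularities, so it is a polynomial in $\cos\theta$, namely the fundamental Lagrange polynomial at the Chebyshev nodes $\cos\theta_k^{(n)}$ evaluated at $\cos\theta$). The Grünwald interpolation operators $G_n:C[0,\pi]\to C[0,\pi]$ are $$G_n(f)(\theta)=\frac12\sum_{k=1}^n f(\theta_k^{(n)})\left\{P_k\left(\theta-\frac{\pi}{2n}\right)+P_k\left(\theta+\frac{\pi}{2n}\right)\right\}.$$ *)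

(* Defs.v *)
From mathcomp Require Import all_boot all_order all_algebra.
From mathcomp Require Import all_classical all_reals all_analysis.

Set Implicit Arguments.
Unset Strict Implicit.
Unset Printing Implicit Defensive.

Import Order.TTheory GRing.Theory Num.Theory.
Import numFieldNormedType.Exports.

Local Open Scope classical_set_scope.
Local Open Scope ring_scope.

Definition cheb_angle {R : realType} (n k : nat) : R :=
  (2 * k%:R - 1) * pi / (2 * n%:R).

(* The bare quotient: at its singularities it takes the junk value 0. *)
Definition lagrange_quot {R : realType} (n k : nat) (t : R) : R :=
  (-1) ^+ k.+1 *
  (cos (n%:R * t) * sin (cheb_angle n k) /
   (n%:R * (cos t - cos (cheb_angle n k)))).

(* P_k(t), the quotient extended by continuity: the limit is taken over
   punctured neighborhoods t^'. *)
Definition cheb_lagrange {R : realType} (n k : nat) (t : R) : R :=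
  if cos t == cos (cheb_angle n k)
  then lim (lagrange_quot n k x @[x --> t^'])
  else lagrange_quot n k t.

Definition grunwald {R : realType} (n : nat) (f : R -> R) (t : R) : R :=
  2^-1 * \sum_(1 <= k < n.+1)
    f (cheb_angle n k) * (cheb_lagrange n k (t - pi / (2 * n%:R)) +
                          cheb_lagrange n k (t + pi / (2 * n%:R))).

Definition L1norm_0pi {R : realType} (f : R -> R) : \bar R :=
  (\int[@lebesgue_measure R]_(t in `[0%R, pi]) `|f t|%:E)%E.

(* Main.v *)
(** The spike supported near the first node [pi / (2n)] that equals 1 there and
    vanishes at the other nodes has arbitrarily small L1 norm, but its image
    under [G_n] does not depend on its width: it is the fixed function
    [(P_1(t - pi/(2n)) + P_1(t + pi/(2n))) / 2], which is bounded below by a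
    positive constant on [[pi/(4n), pi/(2n)]]. *)

Require Import Defs.
From mathcomp Require Import all_boot all_order all_algebra.
From mathcomp Require Import all_classical all_reals all_analysis.
From mathcomp Require Import ring lra.

Import Order.TTheory GRing.Theory Num.Theory.
Import numFieldNormedType.Exports.

Local Open Scope classical_set_scope.
Local Open Scope ring_scope.

(* Unlike [ge0_le_integral], no measurability is required, so the removable
   singularities of [grunwald] need no treatment. *)
Lemma ge0_le_integral_nonmeasurable d (T : measurableType d) (R : realType)
    (mu : {measure set T -> \bar R}) (D : set T) (f g : T -> \bar R) :
  (forall x, D x -> (0 <= f x)%E) -> (forall x, D x -> (f x <= g x)%E) ->
  (\int[mu]_(x in D) f x <= \int[mu]_(x in D) g x)%E.
Proof.
move=> f0 fg; rewrite !ge0_integralE//; last first.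
  by move=> x Dx; exact: le_trans (f0 _ Dx) (fg _ Dx).
(* Each integral is a supremum over simple functions below the integrand, and those below [f] are
   also below [g]. *)
apply: ge_ereal_sup => _ [h /= hf <-].
apply: ereal_sup_ubound; exists h => //= x.
by apply: (le_trans (hf x)); exact: lee_restrict.
Qed.

Section tent.
Context {R : realType}.
Implicit Types (a d x : R).

Definition tent a d x : R := Num.max 0 (1 - `|x - a| / d).

Lemma tent_center a d : tent a d a = 1.
Proof. by rewrite /tent subrr normr0 mul0r subr0 max_r. Qed.

Lemma tent_outside a d x : 0 < d -> d <= `|x - a| -> tent a d x = 0.
Proof. by move=> d0 h; rewrite /tent max_l// subr_le0 ler_pdivlMr// mul1r. Qed.

Lemma tent_ge0 a d x : 0 <= tent a d x.
Proof. by rewrite /tent le_max lexx. Qed.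

Lemma tent_le1 a d x : 0 < d -> tent a d x <= 1.
Proof.
move=> d0; rewrite /tent ge_max ler01/= lerBlDr lerDl.
by rewrite divr_ge0// ltW.
Qed.

Lemma continuous_tent a d : continuous (tent a d).
Proof.
move=> x; apply: (@continuous_max _ _ (cst 0) (fun y => 1 - `|y - a| / d)).
  exact: cvg_cst.
apply: cvgB; first exact: cvg_cst.
apply: cvgMr_tmp; apply: cvg_norm; apply: cvgB; [exact: cvg_id|exact: cvg_cst].
Qed.

(** The tent lies below the indicator of the closed ball of radius [d] about [a], which has measure
    [2 * d]; this crude bound still tends to 0 with [d]. *)
Lemma L1norm_tent_le a d : 0 < d -> (L1norm_0pi (tent a d) <= (d *+ 2)%:E)%E.
Proof.
move=> d0; set B : set R := closed_ball a d.
have mB : measurable B.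
  by rewrite /B closed_ball_itv//; exact: measurable_itv.
rewrite /L1norm_0pi.
apply: (@le_trans _ _
  (\int[@lebesgue_measure R]_(t in `[0%R, pi]) (\1_B t)%:E)%E).
  apply: ge0_le_integral_nonmeasurable => x _; first by rewrite lee_fin.
  rewrite lee_fin ger0_norm ?tent_ge0// indicE.
  have [xB|xB] := boolP (x \in B); first exact: tent_le1.
  rewrite tent_outside//; move: xB; rewrite notin_setE /B closed_ballE//.
  rewrite /closed_ball_ /= distrC => /negP; rewrite -ltNge; exact: ltW.
rewrite integral_indic//.
rewrite -(lebesgue_measure_closed_ball a (ltW d0)).
apply: le_measure; rewrite ?inE//.
by apply: measurableI => //; exact: measurable_itv.
Qed.

End tent.

Section grunwald_tent.
Context {R : realType} {n : nat} (n0 : (0 < n)%N).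

(** [h] plays three roles: the first node, half the spacing of consecutive nodes, and the shift in
    the definition of [grunwald]. *)
Let h : R := pi / (2 * n%:R).

Let nR0 : 0 < n%:R :> R. Proof. by rewrite ltr0n. Qed.

Let h_gt0 : 0 < h. Proof. by rewrite divr_gt0 ?pi_gt0 ?mulr_gt0. Qed.

Let nh : n%:R * h = pi / 2.
Proof. by rewrite /h; field; rewrite gt_eqF. Qed.

Let h_le : h <= pi / 2.
Proof.
by rewrite -nh ler_peMl ?(ltW h_gt0)// -[1]/(1%:R) ler_nat.
Qed.

Let cheb_angle1 : cheb_angle n 1 = h.
Proof. by rewrite /cheb_angle /h; field; rewrite gt_eqF. Qed.

Let cheb_angle_dist (k : nat) : cheb_angle n k = h + (k%:R - 1) * (h *+ 2).
Proof. by rewrite /cheb_angle /h; field; rewrite gt_eqF. Qed.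

(** Every other node is at least [pi / n] away from the first, hence outside the open support of the
    tent, so only the term [k = 1] survives. *)
Lemma grunwald_tent (d t : R) : 0 < d -> d <= pi / n%:R ->
  grunwald n (tent (pi / (2 * n%:R)) d) t =
  2^-1 * (cheb_lagrange n 1 (t - pi / (2 * n%:R)) +
          cheb_lagrange n 1 (t + pi / (2 * n%:R))).
Proof.
rewrite -/h => d0 dh; rewrite /grunwald -/h big_ltn ?ltnS//.
rewrite cheb_angle1 tent_center mul1r big_nat big1 ?addr0// => k /andP[k2 _].
rewrite tent_outside ?mul0r// (le_trans dh)// cheb_angle_dist.
rewrite addrAC subrr add0r ger0_norm; last first.
  by rewrite mulr_ge0 ?mulrn_wge0 ?(ltW h_gt0)// subr_ge0 ler1n ltnW.
have -> : pi / n%:R = h *+ 2 by rewrite /h; field; rewrite gt_eqF.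
rewrite ler_peMl ?mulrn_wge0 ?(ltW h_gt0)// lerBrDr -[leLHS]/(2%:R).
by rewrite ler_nat.
Qed.

(** Since [n * h = pi / 2], the shifts by [h] turn [cos (n * t)] into [sin (n * t)] and its
    negative, while the two denominators also have opposite signs: both summands are positive. *)
Lemma cheb_lagrange_sum_ge (t : R) :
  pi / (2 * n%:R) / 2 <= t <= pi / (2 * n%:R) ->
  2^-1 * (sin (pi / 4) * sin (pi / (2 * n%:R)) / n%:R) <=
  2^-1 * (cheb_lagrange n 1 (t - pi / (2 * n%:R)) +
          cheb_lagrange n 1 (t + pi / (2 * n%:R))).
Proof.
rewrite -/h => /andP[t1 t2].
have pi0 := pi_gt0 R; have h0 := h_gt0; have hpi := h_le.
have c1 : cos h < cos (t - h).
  by rewrite -(cosN (t - h)) opprB ltr_cos ?in_itv/=; lra.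
have c2 : cos (t + h) < cos h by rewrite ltr_cos ?in_itv/=; lra.
(* By the strict inequalities neither shifted point is a singularity, so no limit has to be
   computed. *)
rewrite /cheb_lagrange cheb_angle1 (gt_eqF c1) (lt_eqF c2).
rewrite /lagrange_quot cheb_angle1 expr2 mulrNN !mul1r.
rewrite (mulrBr _ t) (mulrDr _ t) nh cosBpihalf cosDpihalf.
(* On this range [n * t] runs over [[pi / 4, pi / 2]], where sine increases. *)
have snt : sin (pi / 4) <= sin (n%:R * t).
  have ht : n%:R * (h / 2) <= n%:R * t by rewrite ler_pM2l.
  have th : n%:R * t <= n%:R * h by rewrite ler_pM2l.
  rewrite mulrA nh in ht; rewrite nh in th.
  rewrite leNgt ltr_sin ?in_itv/= -?leNgt; lra.
have s4 : 0 < sin (pi / 4 : R) by apply: sin_gt0_pi; lra.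
have sh : 0 < sin h by apply: sin_gt0_pi; lra.
set u := cos (t - h) - cos h; set v := cos h - cos (t + h).
have -> : cos (t + h) - cos h = - v by rewrite opprB.
have u0 : 0 < u by rewrite subr_gt0.
have v0 : 0 < v by rewrite subr_gt0.
have u2 : u <= 2.
  by have := cos_le1 (t - h); have := cos_geN1 h; rewrite /u; lra.
have v2 : v <= 2.
  by have := cos_le1 h; have := cos_geN1 (t + h); rewrite /v; lra.
rewrite ler_pM2l//.
have -> : sin (n%:R * t) * sin h / (n%:R * u) +
    - sin (n%:R * t) * sin h / (n%:R * - v) =
    sin (n%:R * t) * sin h / n%:R * (u^-1 + v^-1).
  by field; rewrite !gt_eqF.
(* Differences of cosines are at most 2, so each reciprocal is at least [1 / 2]. *)
have uv : 1 <= u^-1 + v^-1.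
  have : 2^-1 <= u^-1 by rewrite lef_pV2 ?posrE.
  have : 2^-1 <= v^-1 by rewrite lef_pV2 ?posrE.
  lra.
apply: (@le_trans _ _ (sin (n%:R * t) * sin h / n%:R)).
  by rewrite ler_pM2r ?invr_gt0// ler_pM2r.
rewrite ler_peMr// divr_ge0 ?(ltW nR0)// mulr_ge0 ?(ltW sh)//.
by rewrite (le_trans (ltW s4)).
Qed.

(** The order of quantifiers is the point: [e] is fixed before the width [d]. *)
Lemma L1norm_grunwald_tent_ge : exists2 e : R, 0 < e &
  forall d : R, 0 < d -> d <= pi / n%:R ->
  (e%:E <= L1norm_0pi (grunwald n (tent (pi / (2 * n%:R)) d)))%E.
Proof.
have pi0 := pi_gt0 R; have h0 := h_gt0; have hpi := h_le.
pose c : R := 2^-1 * (sin (pi / 4) * sin h / n%:R).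
have c0 : 0 < c.
  by rewrite mulr_gt0 ?divr_gt0 ?mulr_gt0// sin_gt0_pi//; lra.
(* The pointwise lower bound [c] times the length of [[h / 2, h]]. *)
exists (c * (h / 2)) => [|d d0 dh]; first by rewrite mulr_gt0// divr_gt0.
pose J : set R := `[h / 2, h]%classic.
have mJ : measurable J by exact: measurable_itv.
have -> : (c * (h / 2))%:E =
    (\int[@lebesgue_measure R]_(x in J) cst c%:E x)%E.
  rewrite integral_cst// /J/= lebesgue_measure_itv/= lte_fin ifT; last lra.
  by rewrite -EFinB -EFinM; congr (_ * _)%:E; lra.
have -> : J = `[0, pi]%classic `&` J.
  by apply/esym/setIidPr => x; rewrite /J /= !in_itv/=; lra.
rewrite integral_mkcondr.
apply: ge0_le_integral_nonmeasurable => x _; rewrite patchE.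
  by case: ifPn => // _; rewrite lee_fin ltW.
case: ifPn => [|_]; last by rewrite lee_fin.
rewrite inE /J /= in_itv/= => xJ; rewrite lee_fin grunwald_tent//.
by rewrite (le_trans _ (ler_norm _))// cheb_lagrange_sum_ge.
Qed.

End grunwald_tent.

Theorem theorem1p5 (R : realType) (n : nat) (hn : (0 < n)%N) :
  ~ exists C : R, forall f : R -> R,
      {within `[0, pi], continuous f} ->
      (L1norm_0pi (grunwald n f) <= C%:E * L1norm_0pi f)%E.
Proof.
move=> [C HC]; have [e e0 He] := @L1norm_grunwald_tent_ge R n hn.
(* [C] may be zero or negative; [K] is a positive upper bound by which one can divide. *)
pose K := `|C| + 1; have K0 : 0 < K by rewrite ltr_wpDl.
(* The first entry keeps the other nodes out of the tent; the second gives
   [K * (2 * d) <= e / 2 < e]. *)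
pose d := Num.min (pi / n%:R) (e / (4 * K)).
have d0 : 0 < d.
  by rewrite lt_min !divr_gt0 ?pi_gt0 ?ltr0n ?mulr_gt0.
have dn : d <= pi / n%:R by rewrite ge_min lexx.
have dK : K * (d *+ 2) < e.
  have : d <= e / (4 * K) by rewrite ge_min lexx orbT.
  rewrite ler_pdivlMr ?mulr_gt0// => dK.
  by rewrite -mulr_natr; lra.
pose f := tent (pi / (2 * n%:R)) d.
have /HC Hf : {within `[0, pi], continuous f}.
  exact/continuous_subspaceT/continuous_tent.
have f0 : (0 <= L1norm_0pi f)%E by apply: integral_ge0 => x _; rewrite lee_fin.
suff : (e%:E <= (K * (d *+ 2))%:E)%E by rewrite lee_fin leNgt dK.
apply: le_trans (He _ d0 dn) _; apply: (le_trans Hf).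
apply: (@le_trans _ _ (K%:E * L1norm_0pi f)%E).
  by rewrite lee_wpmul2r// lee_fin /K (le_trans (ler_norm C))// lerDl.
by rewrite EFinM lee_wpmul2l ?lee_fin ?(ltW K0)// L1norm_tent_le.
Qed.
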